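(* Let $E$ be a set-valued expression in $X_1,\dots,X_n$ that is inclusion-exclusion-like, and let $\mathcal{S}$ be its characteristic set. Then for each $1\le k\le n$: if $\mathcal{S}$ contains a set of cardinality $k$, then $\mathcal{S}$ contains every subset of $\bar n$ of cardinality $k$.
   Context: Fix a positive integer $n$ and write $\bar n=\{1,\dots,n\}$. Set-valued expressions in the variables $X_1,\dots,X_n$ are defined recursively: $\emptyset$ is an expression; each $X_i$ is an expression; if $F,F_1,F_2$ are expressions then so are $F^c$, $F_1\cup F_2$, $F_1\cap F_2$. For a sequence of sets $\mathcal{A}=(A_1,\dots,A_n)$ the value $E(\mathcal{A})$ is defined recursively by $\emptyset(\mathcal{A})=\emptyset$, $X_i(\mathcal{A})=A_i$, $(F^c)(\mathcal{A})=(A_1\cup\dots\cup A_n)\setminus F(\mathcal{A})$, $(F_1\cup F_2)(\mathcal{A})=F_1(\mathcal{A})\cup F_2(\mathcal{A})$, $(F_1\cap F_2)(\mathcal{A})=F_1(\mathcal{A})\cap F_2(\mathcal{A})$. Expressions $E,F$ are equivalent, $E\cong F$, if $E(\mathcal{A})=F(\mathcal{A})$ for every sequence of sets $\mathcal{A}$. Finite unions/intersections of expressions are defined up to equivalence; an empty union is $\emptyset$. For $I\subseteq\bar n$ let $G_I=\bigcap_{i\in I}X_i\cap\bigcap_{i\in\bar n\setminus I}X_i^c$, and for $\mathcal{S}\subseteq\mathcal{P}(\bar n)$ let $F_{\mathcal{S}}=\bigcup_{I\in\mathcal{S}}G_I$. The characteristic set of an expression $E$ is the unique $\mathcal{S}\subseteq\mathcal{P}(\bar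 n)\setminus\{\emptyset\}$ with $E\cong F_{\mathcal{S}}$ (such a set exists and is unique). For a sequence of finite sets $\mathcal{A}=(A_1,\dots,A_n)$ and $1\le k\le n$, let $i_{n,k}(\mathcal{A})=\sum_{I\subseteq\bar n,|I|=k}\left|\bigcap_{i\in I}A_i\right|$. An expression $E$ is inclusion-exclusion-like if there exist real constants $c_1,\dots,c_n$ such that for every sequence of finite sets $\mathcal{A}=(A_1,\dots,A_n)$ one has $|E(\mathcal{A})|=\sum_{k=1}^n c_k\, i_{n,k}(\mathcal{A})$. *)

(* Defs.v *)
From HB Require Import structures.
From mathcomp Require Import all_boot all_order all_algebra finmap.
From mathcomp Require Import mathcomp_extra boolp classical_sets functions.
From mathcomp Require Import cardinality reals.

Set Implicit Arguments.
Unset Strict Implicit.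
Unset Printing Implicit Defensive.

Import Order.TTheory GRing.Theory Num.Theory.
Local Open Scope classical_set_scope.

(* The index set {1, ..., n} is represented by 'I_n.                          *)
Inductive expr (n : nat) : Type :=
  | EEmpty
  | EVar of 'I_n
  | ECompl of expr n
  | ECup of expr n & expr n
  | ECap of expr n & expr n.

Arguments EEmpty {n}.

(* A sequence of sets is a family of subsets of an arbitrary common type T;   *)
(* complements are relative to A_1 U ... U A_n, not to T.                     *)
Fixpoint eval (n : nat) (T : Type) (A : 'I_n -> set T) (E : expr n) : set T :=
  match E with
  | EEmpty => set0
  | EVar i => A i
  | ECompl F => (\bigcup_i A i) `\` eval A F
  | ECup F1 F2 => eval A F1 `|` eval A F2
  | ECap F1 F2 => eval A F1 `&` eval A F2
  end.

Definition expr_equiv (n : nat) (E F : expr n) : Prop :=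
  forall (T : Type) (A : 'I_n -> set T), eval A E = eval A F.

(* An empty intersection is read as the complement of EEmpty, whose value     *)
(* A_1 U ... U A_n is neutral for the intersection of values of expressions.  *)
Definition Gexpr (n : nat) (I : {set 'I_n}) : expr n :=
  ECap (\big[@ECap n/ECompl EEmpty]_(i in I) EVar i)
       (\big[@ECap n/ECompl EEmpty]_(i in ~: I) ECompl (EVar i)).

Definition Fexpr (n : nat) (S : {set {set 'I_n}}) : expr n :=
  \big[@ECup n/EEmpty]_(I in S) Gexpr I.

Definition is_characteristic_set (n : nat) (E : expr n)
    (S : {set {set 'I_n}}) : Prop :=
  finset.set0 \notin S /\ expr_equiv E (Fexpr S).

(* fset_set is the underlying finite set of a finite classical set; it is     *)
(* only used on finite sets below (k >= 1, so I is nonempty).                 *)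
Definition inter_sum (n : nat) (T : choiceType) (k : nat) (A : 'I_n -> set T)
    : nat :=
  (\sum_(I : {set 'I_n} | #|I| == k)
     #|` fset_set (\bigcap_(i in [set` I]) A i)|)%N.

(* Only the values c 1, ..., c n of c matter.                                 *)
Definition incl_excl_like (R : realType) (n : nat) (E : expr n) : Prop :=
  exists c : nat -> R,
    forall (T : choiceType) (A : 'I_n -> set T),
      (forall i, finite_set (A i)) ->
      ((#|` fset_set (eval A E)|)%:R =
         \sum_(1 <= k < n.+1) c k * (inter_sum k A)%:R)%R.

Section CharacteristicSet.
Variable n : nat.
Implicit Types (E : expr n) (I : {set 'I_n}) (S : {set {set 'I_n}}).

Lemma eval_sub T (A : 'I_n -> set T) E : eval A E `<=` \bigcup_i A i.
Proof.
elim: E => [|i|F _|F1 H1 F2 H2|F1 H1 F2 H2] x //=.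
- by exists i.
- by case.
- by case; [apply: H1 | apply: H2].
- by case=> /H1.
Qed.

Definition trace T (A : 'I_n -> set T) (x : T) : {set 'I_n} :=
  [set i | `[< A i x >]]%SET.

Lemma trace_neq0 T (A : 'I_n -> set T) x :
  (\bigcup_i A i) x <-> trace A x != finset.set0.
Proof.
split=> [[i _ Aix]|/set0Pn [i]]; last by rewrite inE => /asboolP; exists i.
by apply/set0Pn; exists i; rewrite inE; apply/asboolP.
Qed.

Lemma eval_bigcap T (A : 'I_n -> set T) (P : pred 'I_n) (F : 'I_n -> expr n) x :
  eval A (\big[@ECap n/ECompl EEmpty]_(i | P i) F i) x <->
  (\bigcup_i A i) x /\ forall i, P i -> eval A (F i) x.
Proof.
suff H s : eval A (\big[@ECap n/ECompl EEmpty]_(i <- s | P i) F i) x <->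
    (\bigcup_i A i) x /\ forall i, i \in s -> P i -> eval A (F i) x.
  rewrite H; split=> -[Ux Fx]; split=> // i.
    by apply: Fx; rewrite mem_index_enum.
  by move=> _; exact: Fx.
elim: s => [|j s IH].
  by rewrite big_nil; split=> [[]//|[Ux _]]; split.
rewrite big_cons; case: ifP => Pj; last first.
  rewrite IH; split=> -[Ux Fx]; split=> // i.
    by rewrite inE => /orP[/eqP->|/Fx//]; rewrite Pj.
  by move=> si; apply: Fx; rewrite inE si orbT.
split=> [[Fj /IH [Ux Fx]]|[Ux Fx]].
  by split=> // i; rewrite inE => /orP[/eqP->|/Fx].
split; first by apply: Fx => //; rewrite inE eqxx.
by apply/IH; split=> // i si; apply: Fx; rewrite inE si orbT.
Qed.

Lemma eval_Gexpr T (A : 'I_n -> set T) I x :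
  eval A (Gexpr I) x <-> (\bigcup_i A i) x /\ trace A x = I.
Proof.
split=> [[/eval_bigcap [Ux Ix] /eval_bigcap [_ nIx]]|[Ux <-]].
  split=> //; apply/setP => i; rewrite inE.
  apply/asboolP/idP => [Aix|/Ix//]; apply: contrapT => /negP Ii.
  by have := nIx i; rewrite inE => /(_ Ii) [_].
split; apply/eval_bigcap; split=> // i; rewrite !inE => /asboolP //= nAix.
Qed.

Lemma eval_Fexpr T (A : 'I_n -> set T) S x :
  eval A (Fexpr S) x <-> (\bigcup_i A i) x /\ trace A x \in S.
Proof.
suff H s : eval A (\big[@ECup n/EEmpty]_(I <- s | I \in S) Gexpr I) x <->
    (\bigcup_i A i) x /\ (trace A x \in s) && (trace A x \in S).
  by rewrite H mem_index_enum.
elim: s => [|J s IH]; first by rewrite big_nil; split=> // -[].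
rewrite big_cons inE; case: ifP => SJ.
  split=> [[/eval_Gexpr [Ux ->]|/IH [Ux /andP[-> ->]]]|[Ux]].
  - by rewrite eqxx SJ.
  - by rewrite orbT.
  - case: eqP => [tJ _|_ /= H]; first by left; apply/eval_Gexpr.
    by right; apply/IH.
rewrite IH; case: eqP => //= ->; rewrite SJ !andbF; by [].
Qed.

Lemma eval_trace T U (A : 'I_n -> set T) (B : 'I_n -> set U) E x y :
  trace A x = trace B y -> eval A E x <-> eval B E y.
Proof.
move=> tr; elim: E => [|i|F IH|F1 IH1 F2 IH2|F1 IH1 F2 IH2] //=.
- have /setP /(_ i) := tr; rewrite !inE => e.
  by split=> /asboolP H; apply/asboolP; [rewrite -e | rewrite e].
- by rewrite /setD /mkset IH !trace_neq0 tr.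
- by rewrite /setU /mkset IH1 IH2.
- by rewrite /setI /mkset IH1 IH2.
Qed.

Let V (i : 'I_n) : set {set 'I_n} := [set J | i \in J].

Let trace_V J : trace V J = J.
Proof. by apply/setP => i; rewrite inE asboolb. Qed.

Lemma characteristic_set_exists_unique E : exists! S, is_characteristic_set E S.
Proof.
exists [set I | `[< eval V E I >]]%SET; split.
  split.
    rewrite inE; apply/asboolP => E0.
    by have := proj1 (trace_neq0 V _) (eval_sub E0); rewrite trace_V eqxx.
  move=> T A; apply/seteqP; split=> x.
    move=> Ex; apply/eval_Fexpr; split; first exact: eval_sub Ex.
    have tr : trace A x = trace V (trace A x) by rewrite trace_V.
    by rewrite inE; apply/asboolP; apply: (proj1 (eval_trace E tr)).
  move=> /eval_Fexpr [Ux]; rewrite inE => /asboolP.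
  have tr : trace A x = trace V (trace A x) by rewrite trace_V.
  exact: (proj2 (eval_trace E tr)).
move=> S [S0 /(_ _ V) ES]; apply/setP => I; rewrite inE ES.
apply/asboolP/idP => [/eval_Fexpr [_]|SI]; first by rewrite trace_V.
apply/eval_Fexpr; rewrite trace_neq0 trace_V; split=> //.
by apply: contraNneq S0 => <-.
Qed.

End CharacteristicSet.

(* Main.v *)
(* Test the identity on the family of subsets of a one-point set whose i-th
   member is the whole set exactly when i is in I. Then |E(A)| is 1 or 0
   according to whether I lies in S, while i_{n,k}(A) counts the k-subsets of I
   and hence depends only on |I|. *)
Require Import Defs.
From mathcomp Require Import all_boot all_order all_algebra.
From mathcomp Require Import reals.
From mathcomp Require Import finmap boolp classical_sets cardinality.

Set Implicit Arguments.
Unset Strict Implicit.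

Definition point_family (n : nat) (I : {set 'I_n}) (i : 'I_n) : set unit :=
  [set _ | i \in I]%classic.

Lemma trace_point_family (n : nat) (I : {set 'I_n}) (x : unit) :
  trace (point_family I) x = I.
Proof. by apply/setP => i; rewrite inE /point_family /= asboolb. Qed.

Lemma card_fset_set_unit (A : set unit) (b : bool) :
  (A tt <-> b) -> #|` fset_set A| = b.
Proof.
case: b => Ab.
  have -> : A = [set tt]%classic by apply/seteqP; split=> [[]|[] _] //; apply/Ab.
  by rewrite fset_set1 cardfs1.
have -> : A = set0 by apply/seteqP; split=> [[/Ab]|].
by rewrite fset_set0 cardfs0.
Qed.

(** The single point has trace [I], so it lies in the value of [Fexpr S] exactly when [I] is a
    nonempty member of [S]. *)
Lemma card_eval_point_family (n : nat) (E : expr n) (S : {set {set 'I_n}})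
    (I : {set 'I_n}) : is_characteristic_set E S ->
  #|` fset_set (eval (point_family I) E)| = (I \in S).
Proof.
move=> [S0 ES]; apply: card_fset_set_unit; rewrite ES eval_Fexpr trace_neq0.
rewrite trace_point_family; split=> [[]//|SI]; split=> //.
(* A characteristic set omits the empty set, so [I] is nonempty. *)
by apply: contraNneq S0 => <-.
Qed.

(** The intersection over [K] is the point if [K \subset I] and empty otherwise. For [k = 0] it is
    all of [unit], in accordance with ['C(#|I|, 0) = 1]. *)
Lemma inter_sum_point_family (n k : nat) (I : {set 'I_n}) :
  inter_sum k (point_family I) = 'C(#|I|, k).
Proof.
rewrite /inter_sum -cards_draws -sum1_card [RHS]big_mkcond [LHS]big_mkcond /=.
apply: eq_bigr => K _; rewrite inE.
rewrite (@card_fset_set_unit _ (K \subset I)); first by case: (_ \subset _); case: (_ == _).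
by split=> [H|/fintype.subsetP H i /H]; first by apply/fintype.subsetP => i /H.
Qed.

Theorem theorem3p6 (R : realType) (n : nat) (n_gt0 : (0 < n)%N) (E : expr n)
    (S : {set {set 'I_n}}) (HE : incl_excl_like R E)
    (HS : is_characteristic_set E S) (k : nat) (hk : (1 <= k <= n)%N) :
  (exists I : {set 'I_n}, I \in S /\ #|I| = k) ->
  forall J : {set 'I_n}, #|J| = k -> J \in S.
Proof.
move=> [I [SI cI]] J cJ; have [c Hc] := HE.
(* Membership in [S] becomes a function of the cardinality alone. *)
have EC K : ((K \in S)%:R =
    \sum_(1 <= j < n.+1) c j * 'C(#|K|, j)%:R :> R)%R.
  rewrite -(card_eval_point_family _ HS) Hc => [|i]; last exact: finite_finset.
  by apply: eq_bigr => j _; rewrite inter_sum_point_family.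
(* As [I] and [J] have equal size, [J] outside [S] would give [0 = 1] in [R]. *)
have /eqP := EC J; rewrite cJ -cI -EC SI.
by case: (J \in S) => //; rewrite eq_sym GRing.oner_eq0.
Qed.
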